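(* Let $\mathbb{K}$ be a field of characteristic $\neq 2$, $n\ge 0$, and $a\in Cl(n,n)$. Index rows and columns of $2^n\times 2^n$ matrices by $0,1,\dots,2^n-1$. Then for all $0\le i,j<2^n$, $$\bigl(F_n(\alpha(a))\bigr)_{ij}=(-1)^{|i\oplus j|}\bigl(F_n(a)\bigr)_{ij},$$ where $i\oplus j$ is the bitwise xor of the binary expansions of $i$ and $j$ and $|\cdot|$ denotes the number of bits equal to $1$.
   Context: $Cl(n,n)$ is the Clifford algebra over $\mathbb{K}$ generated by pairwise anticommuting basis vectors $e_0,\dots,e_{n-1}$ (each squaring to $1$) and $\tilde e_0,\dots,\tilde e_{n-1}$ (each squaring to $-1$). $Cl(n-1,n-1)\subset Cl(n,n)$ is the subalgebra generated by the basis vectors with indices $0,\dots,n-2$. $\alpha$ is the parity automorphism: the algebra automorphism sending every basis vector $v$ to $-v$. The maps $F_n: Cl(n,n)\to M_{2^n}(\mathbb{K})$ are defined recursively by $F_0(a)=(a)$ for $a\in Cl(0,0)=\mathbb{K}$ and, for $n\ge 1$ and $A_{ij}\in Cl(n-1,n-1)$, $$F_n(A_{00}+e_{n-1}A_{01}+\tilde e_{n-1}A_{10}+\tilde e_{n-1}e_{n-1}A_{11})=\begin{bmatrix}F_{n-1}(A_{00}+A_{11}) & F_{n-1}(\alpha(A_{01}+A_{10}))\\ F_{n-1}(A_{01}-A_{10}) & F_{n-1}(\alpha(A_{00}-A_{11}))\end{bmatrix}.$$ *)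

(* Defs.v *)
From HB Require Import structures.
From mathcomp Require Import all_boot all_order all_algebra.
From mathcomp Require Import ring.

Set Implicit Arguments.
Unset Strict Implicit.
Unset Printing Implicit Defensive.

Import GRing.Theory.
Local Open Scope ring_scope.

(* The generators of Cl(n,n): (k, false) stands for e_k, whose square is 1,   *)
(* and (k, true) for ~e_k, whose square is -1.                                *)
Notation cgen n := ('I_n * bool)%type.

(* Basis monomials are written with generators in decreasing rank order:      *)
(* ~e_(n-1) e_(n-1) ... ~e_0 e_0.                                             *)
Definition crank n (g : cgen n) : nat := g.1.*2 + g.2.

Definition symdiff (T : finType) (A B : {set T}) : {set T} :=
  (A :\: B) :|: (B :\: A).

(* The algebra Cl(n,n) on the basis of the monomials e_S, S a set of          *)
(* generators; an element is the family of its coordinates.                   *)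
Definition cliff (K : fieldType) (n : nat) := {ffun {set cgen n} -> K^o}.

Section Clifford.
Variables (K : fieldType) (n : nat).
Implicit Types (a b c : cliff K n) (S T U : {set cgen n}) (g h : cgen n).

HB.instance Definition _ := GRing.Lmodule.on (cliff K n).

(* The sign produced when g, standing to the left of h, is brought to its     *)
(* place in the normal order (the square of g if g = h).                      *)
Definition csgn g h : K := (-1) ^+ ((crank g < crank h)%N || (g == h) && g.2).
Definition ccoef S T : K := \prod_(g in S) \prod_(h in T) csgn g h.

Definition cbase S : cliff K n := [ffun T => (T == S)%:R].

(* The bilinear extension of e_S * e_T = +/- e_(S symdiff T).                 *)
Definition cmul a b : cliff K n :=
  \sum_S \sum_T (a S * b T * ccoef S T) *: cbase (symdiff S T).
Definition cone : cliff K n := cbase set0.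

Definition cg g : cliff K n := cbase [set g].

Lemma crank_inj : injective (@crank n).
Proof.
move=> [i b] [j c]; rewrite /crank /= => E.
have Eb : b = c by move/(congr1 odd): E; rewrite !oddD !odd_double !oddb.
congr pair => //; apply: val_inj; apply: double_inj.
by move: E; rewrite Eb => /addIn.
Qed.

Lemma in_symdiff (I : finType) (A B : {set I}) x :
  (x \in symdiff A B) = (x \in A) (+) (x \in B).
Proof. by rewrite !inE; do 2!case: (x \in _). Qed.

Lemma symdiffK (I : finType) (A : {set I}) : involutive (symdiff A).
Proof. by move=> B; apply/setP => x; rewrite !in_symdiff addKb. Qed.

Lemma symdiffA (I : finType) : associative (@symdiff I).
Proof. by move=> A B C; apply/setP => x; rewrite !in_symdiff addbA. Qed.

Lemma symdiff0s (I : finType) : left_id set0 (@symdiff I).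
Proof. by move=> A; apply/setP => x; rewrite !in_symdiff inE. Qed.

Lemma symdiffs0 (I : finType) : right_id set0 (@symdiff I).
Proof. by move=> A; apply/setP => x; rewrite !in_symdiff inE addbF. Qed.

Lemma symdiff_eq (I : finType) (A B C : {set I}) :
  (symdiff A B == C) = (B == symdiff A C).
Proof. by apply/eqP/eqP => [<-|->]; rewrite symdiffK. Qed.

Lemma csgn2 g h : csgn g h * csgn g h = 1.
Proof. by rewrite -expr2 sqrr_sign. Qed.

Lemma prod_symdiff (F : cgen n -> K) S T :
    (forall g, F g * F g = 1) ->
  \prod_(g in symdiff S T) F g = \prod_(g in S) F g * \prod_(g in T) F g.
Proof.
move=> F2; rewrite big_mkcond [X in _ = X * _]big_mkcond [X in _ = _ * X]big_mkcond.
rewrite -big_split /=; apply: eq_bigr => g _.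
by rewrite in_symdiff; do 2!case: (g \in _); rewrite ?mulr1 ?mul1r ?F2.
Qed.

Lemma prod_sq (F : cgen n -> K) S :
  (forall g, F g * F g = 1) -> \prod_(g in S) F g * \prod_(g in S) F g = 1.
Proof. by move=> F2; rewrite -big_split big1 // => g _; apply: F2. Qed.

Lemma ccoefDr S T U : ccoef S (symdiff T U) = ccoef S T * ccoef S U.
Proof.
rewrite /ccoef -big_split /=; apply: eq_bigr => g _.
by rewrite prod_symdiff // => h; apply: csgn2.
Qed.

Lemma ccoefDl S T U : ccoef (symdiff S T) U = ccoef S U * ccoef T U.
Proof. by rewrite /ccoef prod_symdiff // => g; apply: prod_sq => h; apply: csgn2. Qed.

Lemma ccoef2 S T : ccoef S T * ccoef S T = 1.
Proof. by apply: prod_sq => g; apply: prod_sq => h; apply: csgn2. Qed.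

Lemma ccoef0s T : ccoef set0 T = 1. Proof. by rewrite /ccoef big_set0. Qed.
Lemma ccoefs0 S : ccoef S set0 = 1.
Proof. by rewrite /ccoef big1 // => g _; rewrite big_set0. Qed.
Lemma ccoef1s g T : ccoef [set g] T = \prod_(h in T) csgn g h.
Proof. by rewrite /ccoef big_set1. Qed.
Lemma ccoef11 g h : ccoef [set g] [set h] = csgn g h.
Proof. by rewrite ccoef1s big_set1. Qed.

Lemma cmulE a b U :
  cmul a b U = \sum_S a S * b (symdiff S U) * ccoef S (symdiff S U).
Proof.
rewrite /cmul sum_ffunE; apply: eq_bigr => S _; rewrite sum_ffunE.
rewrite (bigD1 (symdiff S U)) //= big1 ?addr0.
  by rewrite !ffunE symdiffK eqxx /GRing.scale /= mulr1.
by move=> T; rewrite eq_sym !ffunE -symdiff_eq eq_sym => /negPf; rewrite /GRing.scale /= eq_sym => ->; rewrite mulr0.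
Qed.

Lemma cmulA : associative cmul.
Proof.
move=> a b c; apply/ffunP => U; rewrite !cmulE.
under [RHS]eq_bigr => S _ do rewrite cmulE !mulr_suml.
rewrite [RHS]exchange_big /=; apply: eq_bigr => R _.
rewrite cmulE mulr_sumr mulr_suml.
rewrite (reindex_inj (can_inj (symdiffK R))) /=; apply: eq_bigr => S _.
have -> : symdiff (symdiff R S) (symdiff R U) = symdiff S U.
  by apply/setP => x; rewrite !in_symdiff addbACA addbb.
have -> : ccoef R (symdiff R U) = ccoef R (symdiff R S) * ccoef R (symdiff S U).
  by rewrite -ccoefDr -symdiffA symdiffK.
rewrite ccoefDl.
have := ccoef2 R (symdiff S U).
set x := ccoef R (symdiff S U); set y := ccoef S _; set z := ccoef R _ => x2.
move: (a R) (b _) (c _) => p q r.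
rewrite -[RHS]mulr1 -x2; ring.
Qed.

Lemma cmul1l : left_id cone cmul.
Proof.
move=> a; apply/ffunP => U; rewrite cmulE (bigD1 set0) //= big1 ?addr0.
  by rewrite ffunE eqxx mul1r symdiff0s ccoef0s mulr1.
by move=> S /negPf S0; rewrite ffunE S0 !mul0r.
Qed.

Lemma cmul1r : right_id cone cmul.
Proof.
move=> a; apply/ffunP => U; rewrite cmulE (bigD1 U) //= big1 ?addr0.
  have -> : symdiff U U = set0.
    by apply/setP => x; rewrite in_symdiff addbb inE.
  by rewrite ffunE eqxx mulr1 ccoefs0 mulr1.
move=> S SU; rewrite ffunE symdiff_eq symdiffs0 eq_sym (negPf SU).
by rewrite mulr0 mul0r.
Qed.

Lemma cmulDl : left_distributive cmul +%R.
Proof.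
move=> a b c; apply/ffunP => U; rewrite ffunE !cmulE -big_split.
by apply: eq_bigr => S _; rewrite ffunE !mulrDl.
Qed.

Lemma cmulDr : right_distributive cmul +%R.
Proof.
move=> a b c; apply/ffunP => U; rewrite ffunE !cmulE -big_split.
by apply: eq_bigr => S _; rewrite ffunE mulrDr mulrDl.
Qed.

Lemma cone_neq0 : cone != 0.
Proof.
apply/eqP => /ffunP/(_ set0)/eqP; rewrite !ffunE eqxx.
exact/negP/oner_neq0.
Qed.

HB.instance Definition _ := GRing.Zmodule_isNzRing.Build (cliff K n)
  cmulA cmul1l cmul1r cmulDl cmulDr cone_neq0.

Lemma cscaleAl (x : K) (a b : cliff K n) : x *: (a * b) = (x *: a) * b.
Proof.
apply/ffunP => U; rewrite ffunE !cmulE scaler_sumr.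
by apply: eq_bigr => S _; rewrite ffunE /GRing.scale /= !mulrA.
Qed.

HB.instance Definition _ :=
  GRing.Lmodule_isLalgebra.Build K (cliff K n) cscaleAl.

Lemma cscaleAr (x : K) (a b : cliff K n) : x *: (a * b) = a * (x *: b).
Proof.
apply/ffunP => U; rewrite ffunE !cmulE scaler_sumr.
by apply: eq_bigr => S _; rewrite ffunE /GRing.scale /= !mulrA (mulrC x).
Qed.

HB.instance Definition _ :=
  GRing.Lalgebra_isAlgebra.Build K (cliff K n) cscaleAr.

Lemma cbaseM S T : cbase S * cbase T = ccoef S T *: cbase (symdiff S T).
Proof.
apply/ffunP => U; rewrite cmulE (bigD1 S) //= big1 ?addr0.
  rewrite !ffunE eqxx mul1r symdiff_eq mulrC /GRing.scale /=.
  by case: eqP => [->|_]; rewrite ?mulr0 // symdiffK.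
by move=> R /negPf RS; rewrite ffunE RS !mul0r.
Qed.

Lemma cliff_sum_base a : a = \sum_S a S *: cbase S.
Proof.
apply/ffunP => U; rewrite sum_ffunE (bigD1 U) //= big1 ?addr0.
  by rewrite !ffunE eqxx /GRing.scale /= mulr1.
by move=> R; rewrite eq_sym !ffunE => /negPf->; rewrite scaler0.
Qed.

(* The families of elements of an algebra that satisfy the defining           *)
(* relations of Cl(n,n).                                                      *)
Definition clifford_rel (A : algType K) (f : cgen n -> A) : Prop :=
  (forall g, f g * f g = (-1) ^+ g.2) /\
  (forall g h, g != h -> f g * f h = - (f h * f g)).

Lemma cg_rel : clifford_rel cg.
Proof.
have sym1 g : symdiff [set g] [set g] = set0.
  by apply/setP => x; rewrite in_symdiff addbb inE.
split=> [g|g h gh]; rewrite /cg !cbaseM !ccoef11.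
  rewrite sym1 /csgn ltnn eqxx /= -[cbase set0]/(1 : cliff K n).
  by case: g.2; rewrite ?expr0 ?expr1 ?scale1r // scaleN1r.
have -> : symdiff [set h] [set g] = symdiff [set g] [set h].
  by apply/setP => x; rewrite !in_symdiff addbC.
rewrite -scaleNr; congr (_ *: _); rewrite /csgn [h == g]eq_sym.
rewrite (negPf gh) /= !orbF.
case: ltngtP => [_|_|/crank_inj /eqP]; last by rewrite (negPf gh).
  by rewrite expr1 expr0.
by rewrite expr1 expr0 opprK.
Qed.

Definition cseq : seq (cgen n) :=
  sort (fun g h => crank h <= crank g)%N (enum {: cgen n}).

Lemma mem_cseq g : g \in cseq. Proof. by rewrite mem_sort mem_enum. Qed.
Lemma cseq_pairwise : pairwise (fun g h => crank h < crank g)%N cseq.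
Proof.
have tr : transitive (fun g h : cgen n => crank h < crank g)%N.
  by move=> x y z xy zx; apply: ltn_trans zx xy.
rewrite -sorted_pairwise //.
have : uniq cseq by rewrite sort_uniq enum_uniq.
have : sorted (fun g h : cgen n => crank h <= crank g)%N cseq.
  by apply: sort_sorted => g h; apply: leq_total.
have tr' : transitive (fun g h : cgen n => crank h <= crank g)%N.
  by move=> x y z xy zx; apply: leq_trans zx xy.
rewrite !sorted_pairwise //; elim: cseq => //= g r IH /andP[gr rr] /andP[ng nr].
rewrite IH // andbT; apply/allP => h hr; rewrite ltn_neqAle (allP gr) // andbT.
by apply: contraNneq ng => /crank_inj <-.
Qed.

Section Lift.
Variables (A : algType K) (f : cgen n -> A).

Definition cmono (S : {set cgen n}) : A := \prod_(g <- cseq | g \in S) f g.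
Definition cliff_lift (a : cliff K n) : A := \sum_S a S *: cmono S.

Lemma cliff_lift_is_linear : linear cliff_lift.
Proof.
move=> x a b; rewrite /cliff_lift scaler_sumr -big_split; apply: eq_bigr => S _.
by rewrite !ffunE scalerDl scalerA.
Qed.
HB.instance Definition _ :=
  GRing.isLinear.Build K (cliff K n) A *:%R cliff_lift cliff_lift_is_linear.

Lemma cliff_lift_base S : cliff_lift (cbase S) = cmono S.
Proof.
rewrite /cliff_lift (bigD1 S) //= big1 ?addr0; first by rewrite ffunE eqxx scale1r.
by move=> T /negPf TS; rewrite ffunE TS scale0r.
Qed.

Lemma cliff_lift1 : cliff_lift 1 = 1.
Proof. by rewrite cliff_lift_base /cmono big1 // => g; rewrite inE. Qed.

Lemma cliff_lift_gen g : cliff_lift (cg g) = f g.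
Proof.
rewrite cliff_lift_base /cmono -big_filter.
have -> : [seq h <- cseq | h \in [set g]] = [:: g]; last by rewrite big_seq1.
under eq_filter => h do rewrite inE.
by rewrite filter_pred1_uniq ?mem_cseq // sort_uniq enum_uniq.
Qed.

Hypothesis ff : clifford_rel f.

Lemma gen_mono g (r : seq (cgen n)) T :
    pairwise (fun g h => crank h < crank g)%N r -> g \in r ->
  f g * \prod_(h <- r | h \in T) f h =
    (\prod_(h <- r | h \in T) csgn g h) *:
      \prod_(h <- r | h \in symdiff [set g] T) f h.
Proof.
case: ff => f2 fA; elim: r => //= k r IH /andP[kr rr]; rewrite inE !big_cons.
rewrite in_symdiff inE; case: (eqVneq g k) => [Egk|gk] /= gr.
  rewrite -{k}Egk in kr *.
  have E1 : \prod_(h <- r | h \in T) csgn g h = 1.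
    rewrite big_seq_cond big1 // => h /andP[hr _].
    have hg := allP kr h hr; rewrite /csgn ltnNge (ltnW hg) /=.
    by case: eqP hg => [->|]; rewrite ?ltnn.
  have E2 : \prod_(h <- r | h \in symdiff [set g] T) f h = 
            \prod_(h <- r | h \in T) f h.
    rewrite big_seq_cond [RHS]big_seq_cond; apply: eq_bigl => h.
    rewrite in_symdiff inE; case hr: (h \in r) => //=.
    by have := allP kr h hr; case: eqP => [->|]; rewrite ?ltnn.
  rewrite E1 E2; case: ifP => gT /=; last by rewrite scale1r.
  by rewrite mulr1 mulrA f2 /csgn ltnn eqxx /=; case: g.2;
    rewrite ?expr0 ?expr1 ?scale1r ?mul1r // scaleN1r mulN1r.
case: ifP => kT; last exact: IH.
rewrite mulrA fA // mulNr -mulrA IH // -scalerAr -scaleNr; congr (_ *: _).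
by rewrite /csgn (allP kr) //= expr1 mulN1r.
Qed.

Lemma cmonoM S T : cmono S * cmono T = ccoef S T *: cmono (symdiff S T).
Proof.
suff H r : pairwise (fun g h => crank h < crank g)%N r ->
    \prod_(g <- r | g \in S) f g * cmono T =
     (\prod_(g <- r | g \in S) \prod_(h in T) csgn g h) *:
       cmono (symdiff [set g in r | g \in S] T).
  rewrite /cmono H ?cseq_pairwise // /ccoef; congr (_ *: cmono _).
    rewrite -big_filter -[RHS]big_filter; apply: perm_big; apply: uniq_perm.
    - by rewrite filter_uniq // sort_uniq enum_uniq.
    - by rewrite filter_uniq // index_enum_uniq.
    - by move=> g; rewrite !mem_filter mem_cseq mem_index_enum.
  by congr symdiff; apply/setP => g; rewrite inE mem_cseq.
elim: r => [_|g r IH] /=.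
  rewrite !big_nil mul1r scale1r; congr cmono; apply/setP => h.
  by rewrite in_symdiff inE.
move=> /andP[gr rr]; rewrite !big_cons; case: ifP => gS; last first.
  rewrite IH //; congr (_ *: cmono (symdiff _ _)); apply/setP => h.
  by rewrite !inE; case: eqP => // ->; rewrite gS !andbF.
rewrite -mulrA IH // -scalerAr gen_mono ?cseq_pairwise ?mem_cseq // scalerA.
congr (_ *: _); last first.
  rewrite /cmono; apply: eq_bigl => h; rewrite symdiffA !in_symdiff !inE.
  case: (eqVneq h g) => [->|] //=; rewrite gS andbT; congr (_ (+) _).
  by case gr': (g \in r) => //; have := allP gr g gr'; rewrite ltnn.
rewrite mulrC; congr (_ * _).
set U := [set h in r | _].
transitivity (\prod_(h in symdiff U T) csgn g h).
  rewrite -big_filter -[RHS]big_filter; apply: perm_big; apply: uniq_perm.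
  - by rewrite filter_uniq // sort_uniq enum_uniq.
  - by rewrite filter_uniq // index_enum_uniq.
  - by move=> h; rewrite !mem_filter mem_cseq mem_index_enum.
rewrite prod_symdiff; last by move=> h; apply: csgn2.
rewrite [X in X * _]big1 ?mul1r // => h; rewrite inE => /andP[hr _].
have hg := allP gr h hr; rewrite /csgn ltnNge (ltnW hg) /=.
by case: eqP hg => [->|]; rewrite ?ltnn.
Qed.

Lemma cliff_liftM : {morph cliff_lift : a b / a * b}.
Proof.
move=> a b; rewrite {1}(cliff_sum_base a) {1}(cliff_sum_base b).
rewrite mulr_suml linear_sum /= [in RHS]/cliff_lift mulr_suml.
apply: eq_bigr => S _; rewrite mulr_sumr linear_sum mulr_sumr.
apply: eq_bigr => T _ /=.
rewrite -!scalerAl -!scalerAr cbaseM !linearZ /= cliff_lift_base.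
by rewrite cmonoM // [RHS]scalerA mulrC -scalerA.
Qed.
End Lift.

Lemma cbase_mono S : cbase S = cmono cg S.
Proof.
suff H r : pairwise (fun g h => crank h < crank g)%N r ->
    \prod_(g <- r | g \in S) cg g = cbase [set g in r | g \in S].
  rewrite /cmono H ?cseq_pairwise //; congr cbase; apply/setP => g.
  by rewrite inE mem_cseq.
elim: r => [_|g r IH] /=.
  by rewrite big_nil; congr cbase; apply/setP => g; rewrite !inE.
move=> /andP[gr rr]; rewrite big_cons IH //; case: ifP => gS; last first.
  by congr cbase; apply/setP => h; rewrite !inE; case: eqP => // ->; rewrite gS !andbF.
rewrite cbaseM ccoef1s big1 ?scale1r.
  congr cbase; apply/setP => h; rewrite in_symdiff !inE.
  case: (eqVneq h g) => [->|] //=; rewrite gS andbT.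
  by case gr': (g \in r) => //; have := allP gr g gr'; rewrite ltnn.
move=> h; rewrite inE => /andP[hr _].
have hg := allP gr h hr; rewrite /csgn ltnNge (ltnW hg) /=.
by case: eqP hg => [->|]; rewrite ?ltnn.
Qed.

(* With cg_rel, cliff_liftM and cliff_lift_gen, this is the universal         *)
(* property of the Clifford algebra.                                          *)
Lemma cliff_lift_unique (A : algType K) (f : cgen n -> A)
    (phi : {lrmorphism cliff K n -> A}) :
  (forall g, phi (cg g) = f g) -> phi =1 cliff_lift f.
Proof.
move=> phif a; rewrite {1}(cliff_sum_base a) linear_sum; apply: eq_bigr => S _.
rewrite linearZ /= cbase_mono rmorph_prod; congr (_ *: _).
by apply: eq_bigr => g _; apply: phif.
Qed.

(* The algebra automorphism g |-> - g (see parity_gen and parityK).           *)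
Definition parity : cliff K n -> cliff K n := cliff_lift (fun g => - cg g).

HB.instance Definition _ := GRing.Linear.on parity.

Lemma opp_rel : clifford_rel (fun g => - cg g).
Proof.
by case: cg_rel => c2 cA; split=> [g|g h gh]; rewrite !mulrNN ?c2 // cA.
Qed.

Lemma parity_is_monoid_morphism : monoid_morphism parity.
Proof. by split; [apply: cliff_lift1 | apply: cliff_liftM opp_rel]. Qed.

HB.instance Definition _ := GRing.isMonoidMorphism.Build
  (cliff K n) (cliff K n) parity parity_is_monoid_morphism.

Lemma parity_gen g : parity (cg g) = - cg g.
Proof. exact: cliff_lift_gen. Qed.

Lemma parityK : involutive parity.
Proof.
move=> a; pose phi := parity \o parity : {lrmorphism _ -> _}.
rewrite -[LHS]/(phi a) (@cliff_lift_unique _ cg); last first.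
  by move=> g; rewrite /phi /= (parity_gen g) rmorphN /= (parity_gen g) opprK.
by apply/esym; apply: (@cliff_lift_unique _ cg idfun).
Qed.

End Clifford.

Section Recursion.
Variable K : fieldType.

Definition cgen_widen n (g : cgen n) : cgen n.+1 :=
  (widen_ord (leqnSn n) g.1, g.2).

Definition e_ n (k : 'I_n) : cliff K n := cg K (k, false).
Definition te_ n (k : 'I_n) : cliff K n := cg K (k, true).

(* The inclusion of Cl(n,n) in Cl(n+1,n+1) as the subalgebra generated by the *)
(* basis vectors of index less than n.                                        *)
Definition cincl n : cliff K n -> cliff K n.+1 :=
  cliff_lift (fun g => cg K (cgen_widen g)).

HB.instance Definition _ n := GRing.Linear.on (@cincl n).

Lemma cgen_widen_inj n : injective (@cgen_widen n).
Proof.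
by move=> [i b] [j c] [/= ij ->]; congr pair; apply: val_inj.
Qed.

Lemma cincl_is_monoid_morphism n : monoid_morphism (@cincl n).
Proof.
split; [exact: cliff_lift1 | apply: cliff_liftM].
case: (cg_rel K n.+1) => c2 cA; split=> [g|g h gh]; first exact: c2.
by apply: cA; rewrite (inj_eq (@cgen_widen_inj n)).
Qed.

HB.instance Definition _ n := GRing.isMonoidMorphism.Build
  (cliff K n) (cliff K n.+1) (@cincl n) (@cincl_is_monoid_morphism n).

Lemma cincl_e n (k : 'I_n) : cincl (e_ k) = e_ (widen_ord (leqnSn n) k).
Proof. exact: cliff_lift_gen. Qed.
Lemma cincl_te n (k : 'I_n) : cincl (te_ k) = te_ (widen_ord (leqnSn n) k).
Proof. exact: cliff_lift_gen. Qed.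

(* The set of generators of the monomial ~e_n^b e_n^c e_S.                    *)
Definition ctop n (b c : bool) (S : {set cgen n}) : {set cgen n.+1} :=
  [set g : cgen n.+1 | (g.1 == ord_max) && (if g.2 then b else c)]
    :|: [set cgen_widen g | g in S].

(* cpart b c a is the component A_bc of a (see cliff_decomp, cpart_cjoin).   *)
Definition cpart n (b c : bool) (a : cliff K n.+1) : cliff K n :=
  [ffun S => a (ctop b c S)].

Lemma expn2S n : (2 ^ n + 2 ^ n = 2 ^ n.+1)%N.
Proof. by rewrite addnn -mul2n expnS. Qed.

(* The matrix F_n(a); the equation on an arbitrary decomposition of a is      *)
(* cliff_mxS, and cliff_decomp and cpart_cjoin give existence and uniqueness  *)
(* of the decomposition.                                                      *)
Fixpoint cliff_mx n : cliff K n -> 'M[K]_(2 ^ n) :=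
  match n with
  | 0 => fun a => const_mx (a set0)
  | n.+1 => fun a =>
      let A00 := cpart false false a in let A01 := cpart false true a in
      let A10 := cpart true false a in let A11 := cpart true true a in
      castmx (expn2S n, expn2S n)
        (block_mx (cliff_mx (A00 + A11)) (cliff_mx (parity (A01 + A10)))
                  (cliff_mx (A01 - A10)) (cliff_mx (parity (A00 - A11))))
  end.

Definition cjoin n (A00 A01 A10 A11 : cliff K n) : cliff K n.+1 :=
  cincl A00 + e_ ord_max * cincl A01 + te_ ord_max * cincl A10
  + te_ ord_max * e_ ord_max * cincl A11.

Lemma widen_max n (g : cgen n) : ((cgen_widen g).1 == ord_max) = false.
Proof. by apply/eqP => /(congr1 val)/= E; have := ltn_ord g.1; rewrite E ltnn. Qed.

Lemma mem_widen n (S : {set cgen n}) g :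
  (cgen_widen g \in [set cgen_widen h | h in S]) = (g \in S).
Proof. exact: (mem_imset _ _ (@cgen_widen_inj n)). Qed.

Lemma mem_ctop_widen n b c (S : {set cgen n}) g :
  (cgen_widen g \in ctop b c S) = (g \in S).
Proof. by rewrite in_setU inE widen_max mem_widen. Qed.

Lemma mem_ctop_max n b c (S : {set cgen n}) d :
  ((ord_max, d) \in ctop b c S) = if d then b else c.
Proof.
rewrite in_setU inE eqxx /=; case: imsetP => [[g _ E]|_]; last by rewrite orbF.
by have := widen_max g; rewrite -E eqxx.
Qed.

Lemma cgenSP n (g : cgen n.+1) :
  (exists h, g = cgen_widen h) \/ (exists b, g = (ord_max, b)).
Proof.
case: g => i b; have [->|ni] := eqVneq i ord_max; first by right; exists b.
have ltin : (i < n)%N.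
  by rewrite ltn_neqAle -ltnS ltn_ord andbT; apply: contraNneq ni => E; apply/eqP/val_inj.
by left; exists (Ordinal ltin, b); congr pair; apply: val_inj.
Qed.

Lemma ctop_eq n b c b' c' (S S' : {set cgen n}) :
  (ctop b c S == ctop b' c' S') = [&& b == b', c == c' & S == S'].
Proof.
apply/eqP/and3P => [E|[/eqP-> /eqP-> /eqP->]] //; split; apply/eqP.
- by rewrite -(mem_ctop_max b c S true) E mem_ctop_max.
- by rewrite -(mem_ctop_max b c S false) E mem_ctop_max.
- by apply/setP => g; rewrite -(mem_ctop_widen b c) E mem_ctop_widen.
Qed.

Lemma ctopP n (T : {set cgen n.+1}) : exists b c S, T = ctop b c S.
Proof.
exists ((ord_max, true) \in T), ((ord_max, false) \in T), (@cgen_widen n @^-1: T).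
apply/setP => g; have [[h ->]|[b ->]] := cgenSP g.
  by rewrite mem_ctop_widen inE.
by rewrite mem_ctop_max; case: b.
Qed.

Lemma crank_widen n (g : cgen n) b : (crank (cgen_widen g) < crank (@ord_max n, b))%N.
Proof.
case: g => i d; rewrite /crank /=; apply: leq_trans (leq_addr _ _).
by rewrite -[in X in (_ <= X)%N](@prednK n) ?doubleS; case: d (ltn_ord i); rewrite ?addn1 ?addn0; case: n i => [[]//|n i] /=; rewrite ltnS -leq_double => H; rewrite ?ltnS // leqW.
Qed.

Lemma cincl_base n (S : {set cgen n}) : cincl (cbase K S) = cbase K (ctop false false S).
Proof.
rewrite /cincl cliff_lift_base.
suff H r : pairwise (fun g h => crank h < crank g)%N r ->
    \prod_(g <- r | g \in S) cg K (cgen_widen g) =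
      cbase K (ctop false false [set g in r | g \in S]).
  rewrite /cmono H ?cseq_pairwise //; congr cbase; congr ctop; apply/setP => g.
  by rewrite inE mem_cseq.
elim: r => [_|g r IH] /=.
  rewrite big_nil; congr cbase; apply/setP => g; rewrite in_set0.
  have [[h ->]|[b ->]] := cgenSP g; first by rewrite mem_ctop_widen inE.
  by rewrite mem_ctop_max; case: b.
move=> /andP[gr rr]; rewrite big_cons IH //; case: ifP => gS; last first.
  congr cbase; congr ctop; apply/setP => h.
  by rewrite !inE; case: eqP => // ->; rewrite gS !andbF.
rewrite cbaseM ccoef1s big1 ?scale1r.
  congr cbase; apply/setP => k; rewrite in_symdiff inE.
  have [[h ->]|[b ->]] := cgenSP k; last first.
    by rewrite !mem_ctop_max; case: eqP => [E|_]; [have := widen_max g; rewrite -E eqxx | case: b].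
  rewrite !mem_ctop_widen (inj_eq (@cgen_widen_inj n)) !inE.
  case: (eqVneq h g) => [->|] //=; rewrite gS andbT.
  by case gr': (g \in r) => //; have := allP gr g gr'; rewrite ltnn.
move=> k; have [[h ->]|[b ->]] := cgenSP k; last by rewrite mem_ctop_max; case: b.
rewrite mem_ctop_widen inE => /andP[hr _].
have hg : (crank (cgen_widen h) < crank (cgen_widen g))%N := allP gr h hr.
rewrite /csgn ltnNge (ltnW hg) /=.
by case: eqP hg => [->|]; rewrite ?ltnn.
Qed.

Lemma max_mul n d b c (S : {set cgen n}) : 
    (if d then ~~ b else ~~ b && ~~ c) ->
  cg K (ord_max, d) * cbase K (ctop b c S) =
  cbase K (ctop (d || b) (~~ d || c) S).
Proof.
move=> Hd; rewrite cbaseM ccoef1s big1 ?scale1r.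
  congr cbase; apply/setP => k; rewrite in_symdiff inE.
  have [[h ->]|[b' ->]] := cgenSP k; last first.
    rewrite !mem_ctop_max xpair_eqE eqxx /=.
    by case: d b c b' Hd => [] [] [] [].
  rewrite !mem_ctop_widen.
  by case: eqP => // E; have := widen_max h; rewrite E eqxx.
move=> k; have [[h ->]|[b' ->]] := cgenSP k.
  move=> _; have hg := crank_widen h d; rewrite /csgn ltnNge (ltnW hg) /=.
  by case: eqP hg => [->|]; rewrite ?ltnn.
rewrite mem_ctop_max /csgn xpair_eqE eqxx /crank /= ltn_add2l.
by case: d b c b' Hd => [] [] [] [].
Qed.

Lemma cincl_sum n b c (x : cliff K n.+1) (A : cliff K n) :
    (forall S, x * cbase K (ctop false false S) = cbase K (ctop b c S)) ->
  x * cincl A = \sum_S A S *: cbase K (ctop b c S).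
Proof.
move=> xE; rewrite {1}(cliff_sum_base A) linear_sum mulr_sumr.
by apply: eq_bigr => S _; rewrite linearZ /= cincl_base -scalerAr xE.
Qed.

Lemma cjoinE n (A00 A01 A10 A11 : cliff K n) :
  cjoin A00 A01 A10 A11 =
    \sum_S A00 S *: cbase K (ctop false false S)
    + \sum_S A01 S *: cbase K (ctop false true S)
    + \sum_S A10 S *: cbase K (ctop true false S)
    + \sum_S A11 S *: cbase K (ctop true true S).
Proof.
rewrite /cjoin -[cincl A00]mul1r.
rewrite (@cincl_sum _ false false 1) => [|S]; last exact: mul1r.
rewrite (@cincl_sum _ false true (e_ ord_max)) => [|S]; last exact: max_mul.
rewrite (@cincl_sum _ true false (te_ ord_max)) => [|S]; last exact: max_mul.
rewrite (@cincl_sum _ true true (te_ ord_max * e_ ord_max)) // => S.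
by rewrite -mulrA !max_mul.
Qed.

Lemma sum_ctop n b c b' c' (A : cliff K n) S :
  (\sum_T A T *: cbase K (ctop b c T) : cliff K n.+1) (ctop b' c' S) =
  if (b == b') && (c == c') then A S else 0.
Proof.
rewrite sum_ffunE (bigD1 S) //= big1 ?addr0.
  rewrite !ffunE ctop_eq eqxx andbT [b' == b]eq_sym [c' == c]eq_sym.
  by case: (_ && _); rewrite /GRing.scale /= ?mulr1 ?mulr0.
move=> T /negPf TS; rewrite !ffunE ctop_eq eq_sym [S == T]eq_sym TS !andbF.
by rewrite scaler0.
Qed.

Lemma cliff_decomp n (a : cliff K n.+1) :
  a = cjoin (cpart false false a) (cpart false true a)
            (cpart true false a) (cpart true true a).
Proof.
apply/ffunP => T; have [b [c [S ->]]] := ctopP T.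
rewrite cjoinE !(ffunE, sum_ctop).
by case: b c => [] []; rewrite /= ?add0r ?addr0.
Qed.

Lemma cpart_cjoin n b c (A : bool -> bool -> cliff K n) :
  cpart b c (cjoin (A false false) (A false true) (A true false) (A true true))
  = A b c.
Proof.
apply/ffunP => S; rewrite ffunE cjoinE !ffunE !sum_ctop.
by case: b c => [] []; rewrite /= ?add0r ?addr0.
Qed.

Lemma cincl_inj n : injective (@cincl n).
Proof.
move=> a b E; pose A x (u v : bool) := if u || v then 0 : cliff K n else x.
have H (x : cliff K n) : cpart false false (cincl x) = x.
  rewrite -[RHS](cpart_cjoin false false (A x)) /cjoin /A /=.
  by rewrite !linear0 !mulr0 !addr0.
by rewrite -(H a) E H.
Qed.

Lemma cliff_mx0 (x : K) : cliff_mx (x%:A : cliff K 0) = const_mx x.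
Proof. by rewrite /= !ffunE eqxx /GRing.scale /= mulr1. Qed.

Lemma cliff0_scalar (a : cliff K 0) : exists x : K, a = x%:A.
Proof.
exists (a set0); apply/ffunP => S; rewrite !ffunE.
have -> : S = set0 by apply/setP => -[[]].
by rewrite eqxx /GRing.scale /= mulr1.
Qed.

Lemma cliff_mxS n (A00 A01 A10 A11 : cliff K n) :
  cliff_mx (cincl A00 + e_ ord_max * cincl A01 + te_ ord_max * cincl A10
            + te_ ord_max * e_ ord_max * cincl A11) =
  castmx (expn2S n, expn2S n)
    (block_mx (cliff_mx (A00 + A11)) (cliff_mx (parity (A01 + A10)))
              (cliff_mx (A01 - A10)) (cliff_mx (parity (A00 - A11)))).
Proof.
pose A b c := if b then if c then A11 else A10 else if c then A01 else A00.
rewrite -/(cjoin A00 A01 A10 A11) /=.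
have H b c := cpart_cjoin b c A; rewrite /= in H.
by rewrite !H.
Qed.

End Recursion.

(* Number of bits equal to 1; as m < 2 ^ m, bits of index >= m are 0.        *)
Definition popcount (m : nat) : nat := \sum_(k < m) Nat.testbit m k.

(* Main.v *)
(* By induction on n: since alpha commutes with the inclusion of Cl(n,n) in   *)
(* Cl(n+1,n+1), the components of alpha(a) are alpha(A00), - alpha(A01),       *)
(* - alpha(A10) and alpha(A11).  So the off-diagonal blocks get an additional *)
(* sign, and these are the blocks where the leading bits of i and j differ.   *)
From Stdlib Require PeanoNat.
Require Import Defs.
From mathcomp Require Import all_boot all_order all_algebra.

Set Implicit Arguments.
Unset Strict Implicit.
Unset Printing Implicit Defensive.

Import GRing.Theory.
Local Open Scope ring_scope.

(** Two sign rules match. [cpart_parity]: the component A_bc is multiplied by b + c new generators,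
    so the parity automorphism contributes (-1)^(b+c) on top of its action on A_bc. Diagonal blocks
    of the matrix involve only A_00 and A_11, off-diagonal ones only A_01 and A_10.
    [popcount_lxor_top]: leading bits b and c, which select the block, add b xor c to the exponent.
    Induction on n handles the entries inside each block. *)

Lemma testbitE m k : Nat.testbit m k = odd (m %/ 2 ^ k).
Proof.
have oddE p : Nat.odd p = odd p.
  (* [Nat.odd] and [Nat.div2] recurse two steps down, hence the induction on consecutive pairs. *)
  have H q : (Nat.odd q = odd q) /\ (Nat.odd q.+1 = odd q.+1).
    by elim: q => [//|q [IH1 IH2]]; split=> //=; rewrite negbK -IH1.
  by case: (H p).
have div2E p : Nat.div2 p = p./2.
  have H q : (Nat.div2 q = q./2) /\ (Nat.div2 q.+1 = q.+1./2).
    elim: q => [//|q [IH1 IH2]]; split=> //.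
    by rewrite -[RHS]/(q./2.+1) -IH1.
  by case: (H p).
elim: k m => [|k IH] m; first by rewrite expn0 divn1 -oddE.
by rewrite /= div2E IH -divn2 -divnMA expnS.
Qed.

Lemma testbit_small m k : (m < 2 ^ k)%N -> Nat.testbit m k = false.
Proof. by move=> mk; rewrite testbitE divn_small. Qed.

Lemma testbit_addl n m k :
  (k < n)%N -> Nat.testbit (2 ^ n + m) k = Nat.testbit m k.
Proof.
move=> kn; rewrite !testbitE -(subnK (ltnW kn)) expnD divnMDl ?expn_gt0 //.
by rewrite oddD oddX subn_eq0 leqNgt kn.
Qed.

Lemma testbit_add_top n m :
  (m < 2 ^ n)%N -> Nat.testbit (2 ^ n + m) n = true.
Proof.
by move=> mn; rewrite testbitE -[X in (X + _)%N]mul1n divnMDl ?expn_gt0 // divn_small.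
Qed.

(** Bits beyond the binary expansion vanish, so any sufficient range gives the same sum; i, j and
    their xor can then share the range n. *)
Lemma popcount_widen m N :
  (m < 2 ^ N)%N -> popcount m = (\sum_(k < N) Nat.testbit m k)%N.
Proof.
have H p q : (p <= q)%N -> (m < 2 ^ p)%N ->
    (\sum_(k < p) Nat.testbit m k = \sum_(k < q) Nat.testbit m k)%N.
  move=> pq mp; rewrite -(subnKC pq) big_split_ord /= [X in (_ + X)%N]big1 ?addn0 //.
  move=> k _; rewrite testbit_small // (leq_trans mp) //.
  by rewrite leq_exp2l // leq_addr.
move=> mN; rewrite /popcount; have mm : (m < 2 ^ m)%N by apply: ltn_expl.
by case/orP: (leq_total m N) => /H ->.
Qed.

(** Otherwise the top bit of the xor, at some position t >= n, would be set, while i and j both have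
    bit t equal to 0. *)
Lemma lxor_lt n i j :
  (i < 2 ^ n)%N -> (j < 2 ^ n)%N -> (Nat.lxor i j < 2 ^ n)%N.
Proof.
move=> ilt jlt; rewrite ltnNge; apply/negP => le.
set x := Nat.lxor i j in le *.
have x0 : (0 < x)%N by apply: leq_trans le; rewrite expn_gt0.
set t := trunc_log 2 x.
have nt : (n <= t)%N by rewrite /t trunc_log_max.
have /andP[lo hi] := trunc_log_bounds (isT : (1 < 2)%N) x0.
have : Nat.testbit x t.
  by rewrite -(subnKC lo) testbit_add_top // ltn_subLR // addnn -mul2n -expnS.
rewrite /x PeanoNat.Nat.lxor_spec !testbit_small //; apply: leq_trans (leq_pexp2l _ nt) => //.
Qed.

Lemma popcount_lxor n i j : (i < 2 ^ n)%N -> (j < 2 ^ n)%N ->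
  popcount (Nat.lxor i j)
    = (\sum_(k < n) (Nat.testbit i k (+) Nat.testbit j k))%N.
Proof.
move=> ilt jlt; rewrite (popcount_widen (lxor_lt ilt jlt)).
by apply: eq_bigr => k _; rewrite PeanoNat.Nat.lxor_spec; do 2!case: Nat.testbit.
Qed.

Lemma popcount_lxor_top n (b c : bool) i j :
    (i < 2 ^ n)%N -> (j < 2 ^ n)%N ->
  popcount (Nat.lxor (b * 2 ^ n + i) (c * 2 ^ n + j))
    = ((b (+) c) + popcount (Nat.lxor i j))%N.
Proof.
have lt (d : bool) m : (m < 2 ^ n)%N -> (d * 2 ^ n + m < 2 ^ n.+1)%N.
  by case: d => mn; rewrite ?mul1n ?mul0n ?add0n expnS mul2n -addnn ?ltn_add2l // ltn_addr.
have low (d : bool) m k : (k < n)%N ->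
    Nat.testbit (d * 2 ^ n + m) k = Nat.testbit m k.
  by case: d => kn; rewrite ?mul1n ?mul0n ?add0n // testbit_addl.
have top (d : bool) m : (m < 2 ^ n)%N -> Nat.testbit (d * 2 ^ n + m) n = d.
  by case: d => mn; rewrite ?mul1n ?mul0n ?add0n ?testbit_add_top ?testbit_small.
move=> ilt jlt; rewrite (@popcount_lxor n.+1) ?lt // (@popcount_lxor n) //.
rewrite big_ord_recr /= !top // addnC; congr addn.
by apply: eq_bigr => k _; rewrite !low.
Qed.

Section Parity.
Variable K : fieldType.

(** Both composites are algebra morphisms with the same values on generators; the universal property
    identifies them. *)
Lemma parity_cincl n (A : cliff K n) : parity (cincl A) = cincl (parity A).
Proof.
pose phi := @parity K n.+1 \o @cincl K n : {lrmorphism _ -> _}.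
pose psi := @cincl K n \o @parity K n : {lrmorphism _ -> _}.
pose f g := - cg K (@cgen_widen n g).
rewrite -[LHS]/(phi A) -[RHS]/(psi A).
have cinclE g : cincl (cg K g) = cg K (cgen_widen g) by exact: cliff_lift_gen.
rewrite (@cliff_lift_unique _ _ _ f); last first.
  by move=> g; rewrite /phi /= cinclE parity_gen.
rewrite (@cliff_lift_unique _ _ _ f psi) // => g.
by rewrite /psi /= parity_gen rmorphN /= cinclE.
Qed.

Lemma parity_cjoin n (A00 A01 A10 A11 : cliff K n) :
  parity (cjoin A00 A01 A10 A11) =
    cjoin (parity A00) (- parity A01) (- parity A10) (parity A11).
Proof.
rewrite /cjoin !rmorphD !rmorphM /= !parity_cincl /e_ /te_ !parity_gen.
by rewrite !rmorphN /= mulrNN !mulNr !mulrN.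
Qed.

Lemma cpart_parity n b c (a : cliff K n.+1) :
  cpart b c (parity a) = (-1) ^+ (b (+) c) *: parity (cpart b c a).
Proof.
(* Packed as one family so that [cpart_cjoin] can be used from right to left. *)
pose A b c := (-1) ^+ (b (+) c) *: parity (cpart b c a).
rewrite -[RHS]/(A b c) -(cpart_cjoin b c A) {1}(cliff_decomp a) parity_cjoin.
by rewrite /A /= !expr0 !expr1 !scale1r !scaleN1r.
Qed.

(** Moves the sign of the off-diagonal blocks out of the recursive calls. *)
Lemma cliff_mxN n (a : cliff K n) : cliff_mx (- a) = - cliff_mx a.
Proof.
elim: n a => [|n IH] a; first by apply/matrixP => i j; rewrite !mxE ffunE.
have cpartN b c : cpart b c (- a) = - cpart b c a.
  by apply/ffunP => S; rewrite !ffunE.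
rewrite /= !cpartN -!opprD !rmorphN /= !IH.
rewrite -opp_block_mx; apply/matrixP => i j.
by rewrite castmxE [LHS]mxE [RHS]mxE castmxE.
Qed.

End Parity.

Theorem mainTheorem5 (K : fieldType) (charK : 2%N \notin [pchar K])
    (n : nat) (a : cliff K n) (i j : 'I_(2 ^ n)) :
  cliff_mx (parity a) i j
    = (-1) ^+ popcount (Nat.lxor i j) * cliff_mx a i j.
Proof.
elim: n a i j => [|n IH] a i j.
  have [x ->] := cliff0_scalar a; rewrite linearZ /= rmorph1 !ord1.
  by rewrite /popcount big_ord0 expr0 mul1r.
rewrite /= !cpart_parity /= !expr0 !expr1 !scale1r !scaleN1r.
rewrite -!opprD -!rmorphD -!rmorphB /= !rmorphN /= !cliff_mxN !castmxE /=.
(* The leading bit b of k selects the half of the block matrix, and k' is the index inside the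
   block. *)
have half (k : 'I_(2 ^ n.+1)) :
    exists (b : bool) (k' : 'I_(2 ^ n)), cast_ord (esym (expn2S n)) k =
      (if b then rshift (2 ^ n) k' else lshift (2 ^ n) k') /\
      (k = b * 2 ^ n + k' :> nat)%N.
  pose k1 := cast_ord (esym (expn2S n)) k.
  case: (splitP k1) => k' E; [exists false|exists true]; exists k'; split.
  - exact: val_inj.
  - by rewrite mul0n add0n -E.
  - exact: val_inj.
  - by rewrite mul1n -E.
have [b [i' [-> ->]]] := half i; have [c [j' [-> ->]]] := half j.
rewrite popcount_lxor_top // exprD -mulrA.
case: b c => [] [];
  rewrite ?block_mxEul ?block_mxEur ?block_mxEdl ?block_mxEdr /=.
(* Right-column blocks already contain a [parity]; there [IH] is applied to that parity image
   itself. *)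
all: by rewrite ?mxE ?IH ?expr0 ?expr1 ?mul1r ?mulN1r.
Qed.
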